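(* Let $T$ be a triangulation of a square. Then (a) if $[a:b:0:\cdots:0]\in V(T)$ with $a,b\neq0$, then $a=\pm b$, and (b) the polynomial $p_T(A_1,A_2,0,\dots,0)$ has the form $c(A_1+A_2)^e(A_1-A_2)^f$ for a constant $c$ and nonnegative integers $e,f$. In particular, all leading coefficients of $p_T$ are equal up to sign.
   Context: A triangulation $T$ (of a square) is an oriented simplicial complex homeomorphic to a closed disk with exactly four vertices on its boundary; these are the corners, labeled $\mathbf{p},\mathbf{q},\mathbf{r},\mathbf{s}$ in the cyclic order determined by the orientation. Let $\Delta_1,\dots,\Delta_n$ be the triangles (2-cells) of $T$, in an arbitrary order, each with the orientation inherited from $T$. A drawing of $T$ is a map $\rho$ from the vertex set of $T$ to $\mathbb{C}^2$ with $\rho(\mathbf{p})+\rho(\mathbf{r})=\rho(\mathbf{q})+\rho(\mathbf{s})$; $X(T)$ is the space of all drawings. For points $p_i=(x_i,y_i)\in\mathbb{C}^2$, $\mathrm{Area}(p_1p_2p_3)=\frac12\det\begin{pmatrix}1&1&1\\ x_1&x_2&x_3\\ y_1&y_2&y_3\end{pmatrix}$, and $\mathrm{Area}_i(\rho)$ is the area of the image under $\rho$ of the (positively ordered) vertices of $\Delta_i$. Let $Y(T)=\mathbb{P}^{n-1}(\mathbb{C})$ with homogeneous coordinates $A_1,\dots,A_n$, one for each triangle. The area map is the rational map $\mathrm{Area}:X(T)\dashrightarrow Y(T)$, $\rho\mapsto[\mathrm{Area}_1(\rho):\dots:\mathrm{Area}_n(\rho)]$, and the area variety $V(T)$ is the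 closure of its image. It is known that $V(T)$ is an irreducible hypersurface; the area polynomial $p_T\in\mathbb{Z}[A_1,\dots,A_n]$ is the irreducible homogeneous polynomial with integer coefficients having no common factor that defines $V(T)$; it is unique up to sign. The leading coefficients of $p_T$ are the coefficients of the monomials $A_i^d$, $1\le i\le n$, where $d=\deg p_T$. *)

(* Defs.v *)
From mathcomp Require Import all_boot all_order all_algebra.
From mathcomp Require Import mpoly complex.
From mathcomp Require Import classical_sets reals topology.

Set Implicit Arguments.
Unset Strict Implicit.
Unset Printing Implicit Defensive.

Import Order.TTheory GRing.Theory Num.Theory.
Import numFieldTopology.Exports.

Local Open Scope classical_set_scope.
Local Open Scope complex_scope.
Local Open Scope ring_scope.

Definition homeomorphic (X Y : topologicalType) (A : set X) (B : set Y) : Prop :=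
  exists (f : X -> Y) (g : Y -> X),
    [/\ {within A, continuous f}, {within B, continuous g},
        (forall x, A x -> B (f x) /\ g (f x) = x) &
        (forall y, B y -> A (g y) /\ f (g y) = y)].

Definition closed_disk (R : realType) : set (R * R)%type :=
  [set z | z.1 ^+ 2 + z.2 ^+ 2 <= 1].
Arguments closed_disk : clear implicits.

(* Barycentric coordinates: the vertex v is the v-th standard basis vector. *)
Definition geometric_realization (R : realType) (m : nat)
    (K : {set {set 'I_m}}) : set 'rV[R]_m :=
  [set x | [/\ forall v, 0 <= x ord0 v,
               \sum_v x ord0 v = 1 &
               [set v | x ord0 v != 0]%SET \in K]].
Arguments geometric_realization R {m} K.

(* [triangle i 0], [triangle i 1], [triangle i 2] are the vertices of the i-th
   triangle in positive order, so that its positively directed edges are the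
   pairs ([triangle i k], [triangle i (ordS k)]). *)
Definition directed_edge (m n : nat) (triangle : 'I_n -> 'I_3 -> 'I_m)
    (u v : 'I_m) : Prop :=
  exists i k, triangle i k = u /\ triangle i (ordS k) = v.

(* An edge of a triangulated surface is on the boundary iff it lies in a single
   triangle; it is directed here as in that triangle. *)
Definition boundary_edge (m n : nat) (triangle : 'I_n -> 'I_3 -> 'I_m)
    (u v : 'I_m) : Prop :=
  directed_edge triangle u v /\ ~ directed_edge triangle v u.

(* Triangulations of a square with vertex set 'I_m and with n triangles, listed
   in an arbitrary order.  By [coherent], two triangles sharing an edge induce
   opposite directions on it.  The corners 0, 1, 2, 3 are p, q, r, s;
   [boundaryP] says that the boundary is the directed 4-cycle p q r s. *)
Record square_triangulation (R : realType) (m n : nat) := SquareTriangulation {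
  simplices : {set {set 'I_m}};
  triangle : 'I_n -> 'I_3 -> 'I_m;
  corner : 'I_4 -> 'I_m;
  simplex_neq0 : forall A : {set 'I_m}, A \in simplices -> (0 < #|A|)%N;
  vertex_in : forall v, [set v]%SET \in simplices;
  face_in : forall A B : {set 'I_m},
    A \in simplices -> B \subset A -> (0 < #|B|)%N -> B \in simplices;
  disk : homeomorphic (geometric_realization R simplices) (closed_disk R);
  triangle_inj : forall i, injective (triangle i);
  triangle_uniq : injective (fun i => [set triangle i k | k : 'I_3]%SET);
  triangleP : forall A : {set 'I_m}, A \in simplices /\ #|A| = 3%N <->
    exists i, A = [set triangle i k | k : 'I_3]%SET;
  coherent : forall i j k l, triangle i k = triangle j l ->
    triangle i (ordS k) = triangle j (ordS l) -> i = j;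
  corner_inj : injective corner;
  boundaryP : forall u v, boundary_edge triangle u v <->
    exists k, u = corner k /\ v = corner (ordS k)
}.

Section AreaVariety.
Variables (R : realType) (m n : nat) (T : square_triangulation R m n).

Definition drawing (rho : 'I_m -> R[i] * R[i]) : Prop :=
  rho (corner T 0) + rho (corner T 2) = rho (corner T 1) + rho (corner T 3).

Definition area (P : 'I_3 -> R[i] * R[i]) : R[i] :=
  2^-1 * \det (\matrix_(a < 3, b < 3)
    (if a == 0 then 1 else if a == 1 then (P b).1 else (P b).2)).

Definition area_map (rho : 'I_m -> R[i] * R[i]) : 'I_n -> R[i] :=
  fun i => area (rho \o triangle T i).

(* Points of the projective space P^(n-1)(C) are given by homogeneous
   coordinates, that is, by nonzero vectors. *)
Definition homog_coords (a : 'I_n -> R[i]) : Prop := exists i, a i != 0.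

Definition area_image : set ('I_n -> R[i]) :=
  [set a | homog_coords a /\ exists2 rho, drawing rho & a = area_map rho].

Definition zariski_closure (S : set ('I_n -> R[i])) : set ('I_n -> R[i]) :=
  [set a | homog_coords a /\
     forall (d : nat) (f : {mpoly R[i][n]}), f \is d.-homog ->
       (forall b, S b -> f.@[b] = 0) -> f.@[a] = 0].

Definition area_variety : set ('I_n -> R[i]) := zariski_closure area_image.

Definition irreducible_elt (A : idomainType) (x : A) : Prop :=
  [/\ x != 0, x \isn't a GRing.unit &
      forall y z, x = y * z -> y \is a GRing.unit \/ z \is a GRing.unit].

Definition area_polynomial (p : {mpoly int[n]}) : Prop :=
  [/\ exists d : nat, p \is d.-homog,
      irreducible_elt p,
      (forall c : int, (forall mu, (c %| p@_mu)%Z) -> c \is a GRing.unit) &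
      (forall a, homog_coords a ->
        (area_variety a <-> (map_mpoly intr p).@[a] = 0))].

End AreaVariety.

(* The polynomial p(0,...,A_i,...,A_j,...,0), still in n variables. *)
Definition restrict_to_pair (n : nat) (i j : 'I_n) (p : {mpoly int[n]}) :
    {mpoly int[n]} :=
  p \mPo [tuple (if (k == i) || (k == j) then 'X_k else 0) | k < n].

(* [msize p] is the degree of p plus one. *)
Definition leading_coefficient (n : nat) (p : {mpoly int[n]}) (i : 'I_n) : int :=
  p@_(U_(i) *+ (msize p).-1)%MM.

(* Main.v *)
From HB Require Import structures.
Require Import Defs.
From mathcomp Require Import all_boot all_order all_algebra.
From mathcomp Require Import mpoly complex ring.
From mathcomp Require Import boolp classical_sets reals topology.

Set Implicit Arguments.
Unset Strict Implicit.
Unset Printing Implicit Defensive.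

Import GRing.Theory Num.Theory.

Local Open Scope ring_scope.

(** Why the theorem holds.  Let [a] be a point of the area variety all of whose
coordinates but the i-th and the j-th vanish, with [s = a i + a j] nonzero.  The
claim is that then [a i = a j] ([two_areas]); everything else follows from it.

The areas of a drawing with indeterminate vertices lie in the function field
[L] of the space of drawings.  Because [a] satisfies every relation between
these areas, dividing by the total area gives elements of [L] that can be
specialized to the numbers [a k / s], and the theorem on extension of places
provides a valuation ring [O] of [L], with maximal ideal [M], in which the k-th
ratio is congruent to [a k / s] ([specialization_valuation]).  In affine
coordinates over [L] for which the parallelogram is the unit square, the doubled
areas of the triangles are therefore in [M], except those of the triangles i
and j, which are congruent to [2 a i / s] and [2 a j / s].

Now Monsky's argument is applied eight times.  A flag of the unit square is a
corner together with a side through it.  It colours the plane over [L] according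
to the reduction modulo [M]: points reducing to the corner, other points
reducing to the side, and the rest.  By Sperner's lemma each flag has a triangle
with vertices of three colours ([exists_rainbow]), and the area of such a
triangle is not in [M] ([rainbow_area]), so that it is the triangle i or the
triangle j.  But a triangle with area in [O] is three-coloured for at most four
of the eight flags, and for four of them only if its vertices reduce to three
corners of the square, in which case its doubled area is 1 or -1 modulo [M]
([rainbow_flags_bound]).  So both triangles attain the bound: [2 a i] and
[2 a j] are equal to [s] or [- s], and since their sum is [2 s] both are [s].

As a consequence, the binary form obtained from the area polynomial by keeping
two variables has no complex zeros besides [1 : 1] and [1 : -1]; in particular
[1 : 0] is not a zero.  Hence, up to its leading coefficient, it is a product of
linear forms [A_i + A_j] and [A_i - A_j]. *)

(** * Extension of places *)

Section ValuationRings.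
Variable K : fieldType.
Implicit Types (x y z : K) (b c : bool) (X : set (K * bool)).

(** Encodes a subring [A] of [K] with an ideal [I] of [A]: the pair [(x, true)]
belongs to [X] when [x] is in [A], and [(x, false)] when [x] is in [I].  As a
single set it is ordered by inclusion, and the closure rules for [A] and [I]
have a common form. *)
Definition ring_with_ideal X : Prop :=
  [/\ X (1, true), X (0, false), (forall x, X (x, false) -> X (x, true)),
      (forall x y b, X (x, b) -> X (y, b) -> X (x - y, b)) &
      (forall x y b c, X (x, b) -> X (y, c) -> X (x * y, b && c))].

Definition proper_ideal X : Prop := ring_with_ideal X /\ ~ X (1, false).

Section Closure.
Variables (X : set (K * bool)) (ringX : ring_with_ideal X).

Lemma pair0 b : X (0, b).
Proof. by case: ringX => _ X0 Xw _ _; case: b => //; exact: Xw. Qed.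

Lemma pairD x y b : X (x, b) -> X (y, b) -> X (x + y, b).
Proof.
case: ringX => _ _ _ XB _ Xx Xy.
by rewrite -[y]opprK -[- y]sub0r; apply/XB/XB/Xy/pair0.
Qed.

Lemma pair_sum (I : Type) (r : seq I) (P : pred I) (F : I -> K) b :
  (forall i, P i -> X (F i, b)) -> X (\sum_(i <- r | P i) F i, b).
Proof.
by move=> XF; elim/big_ind: _ => //; [exact: pair0 | move=> ? ?; exact: pairD].
Qed.

(** The subring [A[z]] with its ideal [I[z]]. *)
Definition adjoin z : set (K * bool) :=
  [set yb | exists2 q : {poly K}, (forall i, X (q`_i, yb.2)) & yb.1 = q.[z]].

Lemma sub_adjoin z yb : X yb -> adjoin z yb.
Proof.
case: yb => y b Xy; exists y%:P => [i|]; last by rewrite hornerC.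
by rewrite coefC; case: eqP => // _; exact: pair0.
Qed.

Lemma adjoin_gen z : adjoin z (z, true).
Proof.
case: (ringX) => X1 _ _ _ _; exists 'X => [i|]; last by rewrite hornerX.
by rewrite coefX; case: eqP => // _; exact: pair0.
Qed.

Lemma adjoin_ring z : ring_with_ideal (adjoin z).
Proof.
case: (ringX) => X1 X0 Xw XB XM; split.
- exact: sub_adjoin.
- exact: sub_adjoin.
- by move=> x [q Xq /= ->]; exists q => // i; exact/Xw/Xq.
- move=> x y b [q Xq /= ->] [r Xr /= ->]; exists (q - r).
    by move=> i; rewrite coefB; exact: XB.
  by rewrite !hornerE.
- move=> x y b c [q Xq /= ->] [r Xr /= ->]; exists (q * r).
    by move=> i; rewrite coefM; apply: pair_sum => j _; exact: XM.
  by rewrite hornerM.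
Qed.

(** Witnesses of degree at most [n] that 1 is in [I[z]]. *)
Definition unit_relation z n : Prop :=
  exists q : {poly K}, [/\ forall i, X (q`_i, false), (size q <= n.+1)%N &
                           q.[z] = 1].

(** Writing [1 - r_0] as a polynomial without constant term in [z^-1] allows
the leading term of [(1 - r_0) * q(z)] to be replaced by terms of lower degree
in [z], without dividing by [1 - r_0]. *)
Lemma unit_relation_lower z n m : z != 0 -> ~ X (1, false) -> (m <= n)%N ->
  unit_relation z n -> unit_relation z^-1 m ->
  exists2 k, (k < n)%N & unit_relation z k.
Proof.
case: (ringX) => X1 _ Xw XB XM z0 nX1 le_mn [q [Xq sq q1]] [r [Xr sr r1]].
case: n => [|n] in le_mn sq *.
  by case: nX1; rewrite -q1 (size1_polyC sq) hornerC.
exists n => //.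
pose c i := (i == 0)%N%:R * r`_0 + (1 - r`_0) * q`_i + q`_n.+1 * r`_(n.+1 - i).
exists (\poly_(i < n.+1) c i); split.
- move=> i; rewrite coef_poly; case: ifP => _; last exact: pair0.
  apply: pairD; [apply: pairD|].
  + by case: eqP => _; rewrite ?mul1r ?mul0r //; exact: pair0.
  + have := XM _ _ true false _ (Xq i); apply.
    by apply: XB => //; exact: Xw.
  + exact: (XM _ _ false false).
- exact: size_poly.
rewrite horner_poly.
have qE : \sum_(i < n.+1) q`_i * z ^+ i = 1 - q`_n.+1 * z ^+ n.+1.
  by rewrite -q1 (horner_coef_wide _ sq) [in RHS]big_ord_recr /= addrK.
have rE : \sum_(i < n.+1) r`_(n.+1 - i) * z ^+ i = z ^+ n.+1 * (1 - r`_0).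
  have sr' : (size r <= n.+2)%N by apply: leq_trans sr _.
  rewrite -r1 (horner_coef_wide _ sr') [in RHS]big_ord_recl /= expr0 mulr1.
  rewrite [r`_0 + _]addrC addrK mulr_sumr (reindex_inj rev_ord_inj) /=.
  apply: eq_bigr => i _; rewrite /bump /= add1n subKn; last exact: ltn_ord.
  rewrite exprVn mulrCA; congr (_ * _).
  have := exprD z (n.+1 - i.+1) i.+1.
  by rewrite (subnK (ltn_ord i)) => ->; rewrite mulfK // expf_neq0.
have -> : \sum_(i < n.+1) c i * z ^+ i =
    r`_0 + (1 - r`_0) * (1 - q`_n.+1 * z ^+ n.+1) +
    q`_n.+1 * (z ^+ n.+1 * (1 - r`_0)).
  have r0E : \sum_(i < n.+1) (i == 0 :> nat)%:R * r`_0 * z ^+ i = r`_0.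
    by rewrite big_ord_recl /= mul1r mulr1 big1 ?addr0 // => i _; rewrite !mul0r.
  rewrite -qE -rE -{1}r0E !mulr_sumr -!big_split; apply: eq_bigr => i _.
  by rewrite /c /=; ring.
by ring.
Qed.

End Closure.

Lemma no_unit_relations X z n m : proper_ideal X -> z != 0 ->
  unit_relation X z n -> unit_relation X z^-1 m -> False.
Proof.
case=> rX nX1; move: {2}(n + m).+1 (ltnSn (n + m)) => N.
elim: N z n m => // N IH z n m ltN z0 zn zm.
have [le_mn|/ltnW le_nm] := leqP m n.
  have [k ltkn zk] := unit_relation_lower rX z0 nX1 le_mn zn zm.
  apply: (IH _ _ _ _ z0 zk zm); rewrite -ltnS; apply: leq_trans ltN.
  by rewrite ltnS -addSn leq_add2r.
have zn' : unit_relation X z^-1^-1 n by rewrite invrK.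
have [k ltkm zk] := unit_relation_lower rX (invr_neq0 z0) nX1 le_nm zm zn'.
apply: (IH _ _ _ _ z0 zn zk); rewrite -ltnS; apply: leq_trans ltN.
by rewrite ltnS -addnS leq_add2l.
Qed.

Definition valuation_ring (O : {pred K}) : Prop :=
  subring_closed O /\ forall x, x \in O \/ x^-1 \in O.

Definition maximal_ideal (O : {pred K}) : {pred K} :=
  [pred x in O | (x == 0) || (x^-1 \notin O)].

(** The union of a chain of proper pairs is proper, as each closure rule
involves at most two elements. *)
Lemma maximal_pair X0 : proper_ideal X0 -> exists X,
  [/\ proper_ideal X, X0 `<=` X &
      forall Y, proper_ideal Y -> X `<=` Y -> Y `<=` X]%classic.
Proof.
move=> pX0.
(* Zorn's lemma is applied to the sets that become proper pairs once [X0] is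
   added to them, so that the empty chain is harmless. *)
have [F PF totF|X [pX maxX]] := @Zorn_bigcup (K * bool)%type
  [set X | proper_ideal (X `|` X0)]%classic.
- rewrite /=; set U := (_ `|` X0)%classic.
  have common u v : U u -> U v ->
      exists Y, [/\ proper_ideal Y, Y `<=` U, Y u & Y v]%classic.
    have FU Y : F Y -> (Y `|` X0 `<=` U)%classic.
      by move=> FY w [Yw|]; [left; exists Y | right].
    case=> [[Y FY Yu]|Xu] [[Z FZ Zv]|Xv].
    + have [YZ|ZY] := totF _ _ FY FZ.
      * by exists (Z `|` X0)%classic; split; [exact: PF|exact: FU|left; exact: YZ|left].
      * by exists (Y `|` X0)%classic; split; [exact: PF|exact: FU|left|left; exact: ZY].
    + by exists (Y `|` X0)%classic; split; [exact: PF|exact: FU|left|right].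
    + by exists (Z `|` X0)%classic; split; [exact: PF|exact: FU|right|left].
    + by exists X0; split => // w; right.
  case: (pX0) => [[X1 X00 Xw XB XM] nX1]; split; last first.
    by move=> U1; have [Y [[_ nY1] _ /nY1]] := common _ _ U1 U1.
  split; [by right|by right| | |].
  + move=> x Ux; have [Y [[[_ _ Yw _ _] _] sYU Yx _]] := common _ _ Ux Ux.
    exact/sYU/Yw.
  + move=> x y b Ux Uy; have [Y [[[_ _ _ YB _] _] sYU Yx Yy]] := common _ _ Ux Uy.
    exact/sYU/YB.
  + move=> x y b c Ux Uy; have [Y [[[_ _ _ _ YM] _] sYU Yx Yy]] := common _ _ Ux Uy.
    exact/sYU/YM.
exists (X `|` X0)%classic; split => //.
move=> Y pY sXY y Yy; apply: contrapT => nXy.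
have YE : (Y `|` X0 = Y)%classic.
  by apply/seteqP; split => w; [case=> // Xw; apply: sXY; right|left].
apply: (maxX Y); last by rewrite /= YE.
split; first by move=> w Xw; apply: sXY; left.
by move=> sYX; apply: nXy; left; exact: sYX.
Qed.

(** In a maximal proper pair [A] is a valuation ring: if neither [z] nor [z^-1]
were in [A], adjoining either would make the ideal improper, and the two
resulting relations could be lowered forever.  This is the theorem on extension
of places, in the form: a subring with a proper ideal is dominated by a
valuation ring. *)
Lemma dominating_valuation_ring X0 : proper_ideal X0 ->
  exists O, [/\ valuation_ring O, forall x, X0 (x, true) -> x \in O &
                forall x, X0 (x, false) -> x \in maximal_ideal O].
Proof.
move=> pX0; have [X [pX sX0 maxX]] := maximal_pair pX0.
have [rX nX1] := pX; have [X1 X00 Xw XB XM] := rX.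
pose O : {pred K} := fun x => `[< X (x, true) >].
have OE x : x \in O <-> X (x, true).
  by split => /asboolP.
exists O; split.
- split; first split.
  + exact/OE.
  + by move=> x y /OE Xx /OE Xy; apply/OE; exact: XB.
  + by move=> x y /OE Xx /OE Xy; apply/OE; have := XM _ _ _ _ Xx Xy.
  move=> x; have [->|x0] := eqVneq x 0; first by left; apply/OE; exact: pair0.
  have adj z : ~ X (z, true) -> exists n, unit_relation X z n.
    move=> nXz; apply: contrapT => nrel; apply: nXz.
    apply: (maxX (adjoin X z)); last exact: adjoin_gen.
      split; first exact: adjoin_ring.
      case=> q Xq q1; apply: nrel; exists (size q), q; split=> //.
    by move=> y; exact: sub_adjoin.
  have [|nx] := pselect (X (x, true)); first by left; apply/OE.
  have [|nxV] := pselect (X (x^-1, true)); first by right; apply/OE.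
  have [n xn] := adj _ nx; have [m xm] := adj _ nxV.
  by case: (no_unit_relations pX x0 xn xm).
- by move=> x /sX0 /OE.
move=> x /sX0 Xx; apply/andP; split; first exact/OE/Xw.
have [//|x0 /=] := eqVneq x 0; apply/negP => /OE XVx; apply: nX1.
by rewrite -(mulVf x0); exact: (XM _ _ true false).
Qed.

End ValuationRings.

(** * Three-colourings of the vertices of a triangle *)

(** Twice the signed area, which avoids the denominator 2. *)
Definition dbl_area (A : comNzRingType) (P Q S : A * A) : A :=
  (Q.1 - P.1) * (S.2 - P.2) - (S.1 - P.1) * (Q.2 - P.2).

Variant colour := Corner | Side | Off.

(** An antisymmetric function on edges whose sum around a triangle is [1] or
[-1] when the three colours occur, and 0 otherwise. *)
Definition colour_step (c d : colour) : int :=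
  match c, d with Corner, Side => 1 | Side, Corner => -1 | _, _ => 0 end.

Definition rainbow_sign (c : 'I_3 -> colour) : int :=
  \sum_k colour_step (c k) (c (ordS k)).

Definition rainbow (c : 'I_3 -> colour) : bool := rainbow_sign c != 0.

Lemma rainbow_signE c : rainbow_sign c =
  colour_step (c 0) (c 1) + colour_step (c 1) (c 2) + colour_step (c 2) (c 0).
Proof.
rewrite /rainbow_sign !big_ord_recl big_ord0 addr0 addrA.
by congr (colour_step (c _) (c _) + colour_step (c _) (c _) +
  colour_step (c _) (c _)); exact: val_inj.
Qed.

Lemma ord3P (i : 'I_3) : [\/ i = 0, i = 1 | i = 2].
Proof.
by case: i => [[|[|[|//]]] lti]; [constructor 1|constructor 2|constructor 3];
  exact: val_inj.
Qed.

Lemma rainbowP c : reflect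
  (exists i j k, [/\ c i = Corner, c j = Side & c k = Off]) (rainbow c).
Proof.
rewrite /rainbow rainbow_signE.
apply: (iffP idP) => [|[i [j [k []]]]]; last first.
  by case: (ord3P i) => ->; case: (ord3P j) => ->; case: (ord3P k) => -> -> //;
    move=> -> // ->.
case c0: (c 0); case c1: (c 1); case c2: (c 2) => //= _.
- by exists 0, 1, 2.
- by exists 0, 2, 1.
- by exists 1, 0, 2.
- by exists 2, 0, 1.
- by exists 1, 2, 0.
- by exists 2, 1, 0.
Qed.

(** * Flags of the unit square, on residues *)

(** The information on a coordinate modulo [M] that the eight flags see. *)
Variant residue := Zero | One | Other.

(** The effect of [x |-> 1 - x] on residues. *)
Definition flip (r : residue) :=
  match r with Zero => One | One => Zero | Other => Other end.

Definition residue_int (r : residue) : int := if r is One then 1 else 0.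

(** A flag is given by the symmetry of the unit square that carries it to the
corner (0, 0) with the side on the first axis: reflections of the coordinates,
then possibly their exchange. *)
Definition residue_chart (f : bool * bool * bool) (p : residue * residue) :=
  let: (sw, fx, fy) := f in
  let x := if fx then flip p.1 else p.1 in
  let y := if fy then flip p.2 else p.2 in
  if sw then (y, x) else (x, y).

(** The colouring attached to the corner (0, 0) and the first axis. *)
Definition residue_colour (p : residue * residue) : colour :=
  match p with (Zero, Zero) => Corner | (_, Zero) => Side | _ => Off end.

Definition flags : seq (bool * bool * bool) :=
  let bools := [:: true; false] in
  [seq (f, fy) | f <- [seq (sw, fx) | sw <- bools, fx <- bools], fy <- bools].

(** The second condition makes the three corners distinct and fixes the doubled
area up to sign. *)
Definition corner_triangle (p : 'I_3 -> residue * residue) : Prop :=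
  (forall k, (p k).1 <> Other /\ (p k).2 <> Other) /\
  let area := dbl_area (residue_int (p 0).1, residue_int (p 0).2)
         (residue_int (p 1).1, residue_int (p 1).2)
         (residue_int (p 2).1, residue_int (p 2).2) in
  area = 1 \/ area = -1.

(** Only a vertex at a corner contributes flags, and at most two. If it
contributes both, then the other two vertices lie on the lines of the two sides
through it, one on each, so that they contribute at most one flag each, and
exactly one when they are corners. If no vertex contributes both, there are at
most three flags. The proof inspects the 729 triples of residues. *)
Lemma residue_flags (p : 'I_3 -> residue * residue) :
  let v := count (fun f =>
    rainbow (fun k => residue_colour (residue_chart f (p k)))) flags in
  (v <= 4)%N /\ (v = 4%N -> corner_triangle p).
Proof.
move=> v.
pose sign f := let c k := residue_colour (residue_chart f k) in
  colour_step (c (p 0)) (c (p 1)) + colour_step (c (p 1)) (c (p 2))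
  + colour_step (c (p 2)) (c (p 0)) != 0.
have {v}-> : v = count sign flags.
  by apply: eq_count => f; rewrite /rainbow rainbow_signE.
have cornerE : corner_triangle p <->
  [/\ (p 0).1 <> Other /\ (p 0).2 <> Other, (p 1).1 <> Other /\ (p 1).2 <> Other,
      (p 2).1 <> Other /\ (p 2).2 <> Other &
  let area := dbl_area (residue_int (p 0).1, residue_int (p 0).2)
         (residue_int (p 1).1, residue_int (p 1).2)
         (residue_int (p 2).1, residue_int (p 2).2) in
  area = 1 \/ area = -1].
  split=> [[xs ?]|[x0 x1 x2 ?]]; split=> // k.
  case: k => [[|[|[|//]]] ltk].
  + by have -> : Ordinal ltk = 0 by exact: val_inj.
  + by have -> : Ordinal ltk = 1 by exact: val_inj.
  + by have -> : Ordinal ltk = 2 by exact: val_inj.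
rewrite cornerE /sign {sign cornerE}.
by case: (p 0) => [[] []]; case: (p 1) => [[] []]; case: (p 2) => [[] []];
  vm_compute; split=> // _; split=> //; solve [by left | by right].
Qed.

(** * Reduction modulo the maximal ideal of a valuation ring *)

Section Reduction.
Variables (K : fieldType) (O : {pred K}).
Hypothesis valO : valuation_ring O.
Let M := maximal_ideal O.
Implicit Types (x y : K) (P Q : K * K).

Let ringO : subring_closed O := valO.1.

Lemma val1 : 1 \in O. Proof. by case: ringO. Qed.
Lemma valB x y : x \in O -> y \in O -> x - y \in O.
Proof. by case: ringO => _ + _; apply. Qed.
Lemma valM x y : x \in O -> y \in O -> x * y \in O.
Proof. by case: ringO => _ _; apply. Qed.
Lemma val0 : 0 \in O. Proof. by rewrite -(subrr 1) valB ?val1. Qed.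
Lemma valN x : x \in O -> - x \in O.
Proof. by rewrite -sub0r; exact/valB/val0. Qed.
Lemma valD x y : x \in O -> y \in O -> x + y \in O.
Proof. by move=> Ox Oy; rewrite -[y]opprK valB ?valN. Qed.

Lemma maxi_val x : x \in M -> x \in O. Proof. by case/andP. Qed.

Lemma maxi0 : 0 \in M. Proof. by rewrite inE /= val0 eqxx. Qed.

Lemma maxi1 : 1 \notin M.
Proof. by rewrite inE /= val1 oner_eq0 invr1 val1. Qed.

Lemma val_inv x : x \notin M -> x^-1 \in O.
Proof.
case: (valO.2 x) => // Ox; rewrite inE /= Ox negb_or negbK.
by case/andP.
Qed.

Lemma maxi_inv x : x \notin O -> x^-1 \in M.
Proof.
move=> nOx; case: (valO.2 x) => [|OVx]; first by rewrite (negbTE nOx).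
by rewrite inE /= OVx invrK nOx orbT.
Qed.

Lemma maxiMl x y : x \in O -> y \in M -> x * y \in M.
Proof.
move=> Ox /andP[Oy my]; rewrite inE /= valM //=.
have [//|xy0 /=] := eqVneq (x * y) 0.
have [x0 y0] : x != 0 /\ y != 0 by apply/andP; rewrite -negb_or -mulf_eq0.
move: my; rewrite (negbTE y0) /=; apply: contra => OVxy.
by rewrite -[y^-1](mulVKf x0) -invfM valM.
Qed.

Lemma maxiMr x y : x \in M -> y \in O -> x * y \in M.
Proof. by move=> Mx Oy; rewrite mulrC maxiMl. Qed.

Lemma maxiN x : x \in M -> - x \in M.
Proof. by rewrite -mulN1r; apply: maxiMl; rewrite valN ?val1. Qed.

Lemma maxiD x y : x \in M -> y \in M -> x + y \in M.
Proof.
move=> Mx My; have [->|x0] := eqVneq x 0; first by rewrite add0r.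
have [->|y0] := eqVneq y 0; first by rewrite addr0.
case: (valO.2 (x / y)) => [Oxy|].
  have -> : x + y = (x / y + 1) * y by rewrite mulrDl divfK ?mul1r.
  by rewrite maxiMl ?valD ?val1.
rewrite invf_div => Oyx.
have -> : x + y = (1 + y / x) * x by rewrite mulrDl divfK ?mul1r.
by rewrite maxiMl ?valD ?val1.
Qed.

Lemma maxiB x y : x \in M -> y \in M -> x - y \in M.
Proof. by move=> Mx My; rewrite maxiD ?maxiN. Qed.

Definition chart (f : bool * bool * bool) (P : K * K) : K * K :=
  let: (sw, fx, fy) := f in
  let x := if fx then 1 - P.1 else P.1 in
  let y := if fy then 1 - P.2 else P.2 in
  if sw then (y, x) else (x, y).

(** In terms of the valuation: [Off] when the second coordinate dominates 1 and
the first one, [Side] when instead the first coordinate dominates 1 and is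
strictly larger than the second, and [Corner] when both coordinates are in [M].
Points with coordinates outside of [O] are coloured as well: they reduce to
points at infinity of the projective plane. *)
Definition flag_colour (P : K * K) : colour :=
  if (P.2 \notin M) && (P.1 / P.2 \in O) then Off
  else if P.1 \notin M then Side else Corner.

Variant flag_colour_spec (P : K * K) : colour -> Prop :=
| FlagOff of P.2 \notin M & P.1 / P.2 \in O : flag_colour_spec P Off
| FlagSide of P.1 \notin M & P.2 / P.1 \in M : flag_colour_spec P Side
| FlagCorner of P.1 \in M & P.2 \in M : flag_colour_spec P Corner.

Lemma flag_colourP P : flag_colour_spec P (flag_colour P).
Proof.
have nz x : x \notin M -> x != 0 by apply: contraNneq => ->; exact: maxi0.
rewrite /flag_colour; case: ifP => [/andP[]|]; first by constructor.
move=> /negbT; rewrite negb_and negbK => nOff.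
have ratio : P.2 \notin M -> P.2 / P.1 \in M.
  by move=> nM2; move: nOff; rewrite (negbTE nM2) /= => /maxi_inv; rewrite invf_div.
case: ifPn => [nM1|/negPn M1]; constructor => //.
  have [M2|/ratio//] := boolP (P.2 \in M).
  by rewrite maxiMr // val_inv.
have [//|nM2] := boolP (P.2 \in M).
have [P10|P10] := eqVneq P.1 0; first by move: nOff; rewrite (negbTE nM2) P10 mul0r val0.
have := maxiMr (ratio nM2) (maxi_val M1).
by rewrite divfK // (negbTE nM2).
Qed.

(** The determinant that computes the area is dominated by the product of the
first coordinate of the point on the side and the second coordinate of the point
off it: after division by this product it is 1 modulo [M].  As both factors are
at least 1 in absolute value, an area in [O] forces all the coordinates that
matter to be in [O]. *)
Lemma rainbow_area P Q S :
  flag_colour P = Corner -> flag_colour Q = Side -> flag_colour S = Off ->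
  dbl_area P Q S \in O ->
  [/\ dbl_area P Q S \notin M, (Q.1 \in O) && (Q.2 \in M) &
      (S.1 \in O) && (S.2 \in O)].
Proof.
case: flag_colourP => // MP1 MP2 _; case: flag_colourP => // nMQ1 MQ _.
case: flag_colourP => // nMS2 OS _ Oarea.
have nz x : x \notin M -> x != 0 by apply: contraNneq => ->; exact: maxi0.
have [Q0 S0] := (nz _ nMQ1, nz _ nMS2).
have [VQ VS] := (val_inv nMQ1, val_inv nMS2).
pose e := (1 - P.1 / Q.1) * (1 - P.2 / S.2)
          - (S.1 / S.2 - P.1 / S.2) * (Q.2 / Q.1 - P.2 / Q.1).
have areaE : dbl_area P Q S = Q.1 * S.2 * e.
  by rewrite /dbl_area /e; field; rewrite Q0 S0.
have Me : e - 1 \in M.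
  have -> : e - 1 = P.1 / Q.1 * (P.2 / S.2) - P.1 / Q.1 - P.2 / S.2
            - (S.1 / S.2 - P.1 / S.2) * (Q.2 / Q.1 - P.2 / Q.1).
    by rewrite /e; ring.
  have Ma : P.1 / Q.1 \in M by rewrite maxiMr.
  have Mb : P.2 / S.2 \in M by rewrite maxiMr.
  have Oc : S.1 / S.2 - P.1 / S.2 \in O by rewrite valB // valM // maxi_val.
  have Md : Q.2 / Q.1 - P.2 / Q.1 \in M by rewrite maxiB // maxiMr.
  by apply: maxiB; [apply: maxiB => //; apply: maxiB => //; rewrite maxiMr // maxi_val
                   |rewrite maxiMl].
have nMe : e \notin M.
  apply: contra (maxi1) => M_e; by rewrite -(subKr e 1) maxiB.
have Oprod : Q.1 * S.2 \in O.
  by rewrite -[_ * _](mulfK (nz _ nMe)) -areaE valM ?val_inv.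
have OQ1 : Q.1 \in O by rewrite -[Q.1](mulfK S0) valM.
have OS2 : S.2 \in O by rewrite -[S.2](mulKf Q0) valM.
split.
- apply: contra (maxi1) => Marea.
  have -> : 1 = Q.1^-1 * S.2^-1 * (dbl_area P Q S / e).
    by rewrite areaE; field; rewrite Q0 S0 nz.
  by rewrite maxiMl ?valM // maxiMr ?val_inv.
- by rewrite OQ1 -[Q.2](divfK Q0) maxiMr.
- by rewrite OS2 -[S.1](divfK S0) valM.
Qed.

Definition residue_of x : residue :=
  if x \in M then Zero else if 1 - x \in M then One else Other.

Lemma residue_flip x : residue_of (1 - x) = flip (residue_of x).
Proof.
rewrite /residue_of subKr; case: ifP => [M1x|]; case: ifP => // Mx.
by have := maxi1; rewrite -[1](subrK x) maxiD.
Qed.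

Definition residues P := (residue_of P.1, residue_of P.2).

Lemma residues_chart f P : residues (chart f P) = residue_chart f (residues P).
Proof.
by case: f => [[[] []] []]; rewrite /residues /chart /= ?residue_flip.
Qed.

Lemma dbl_area_chart f P Q S :
  dbl_area (chart f P) (chart f Q) (chart f S) = dbl_area P Q S \/
  dbl_area (chart f P) (chart f Q) (chart f S) = - dbl_area P Q S.
Proof.
by case: f => [[[] []] []]; rewrite /dbl_area /=;
  solve [left; ring | right; ring].
Qed.

(** Colours name the vertices in an order that need not be the given one. *)
Lemma dbl_area_perm (P : 'I_3 -> K * K) a b c : a != b -> a != c -> b != c ->
  dbl_area (P a) (P b) (P c) = dbl_area (P 0) (P 1) (P 2) \/
  dbl_area (P a) (P b) (P c) = - dbl_area (P 0) (P 1) (P 2).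
Proof.
case: (ord3P a) => ->; case: (ord3P b) => ->; case: (ord3P c) => -> //= _ _ _;
  rewrite /dbl_area; solve [left; ring | right; ring].
Qed.

(** By the previous estimate a three-coloured triangle with area in [O] has no
vertex at infinity, so that its colours can be read off the residues. *)
Lemma rainbow_residues f (P : 'I_3 -> K * K) :
  dbl_area (P 0) (P 1) (P 2) \in O ->
  rainbow (fun k => flag_colour (chart f (P k))) ->
  dbl_area (P 0) (P 1) (P 2) \notin M /\
  rainbow (fun k => residue_colour (residue_chart f (residues (P k)))).
Proof.
move=> Oarea /rainbowP[a [b [c [cola colb colc]]]].
have ab : a != b by apply/eqP => E; move: cola; rewrite E colb.
have ac : a != c by apply/eqP => E; move: cola; rewrite E colc.
have bc : b != c by apply/eqP => E; move: colb; rewrite E colc.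
pose A := dbl_area (chart f (P a)) (chart f (P b)) (chart f (P c)).
have areaE : A = dbl_area (P 0) (P 1) (P 2) \/ A = - dbl_area (P 0) (P 1) (P 2).
  rewrite /A; have [->|->] := dbl_area_chart f (P a) (P b) (P c);
  by have [->|->] := dbl_area_perm P ab ac bc; rewrite ?opprK; solve [by left | by right].
have OA : A \in O by case: areaE => ->; rewrite ?valN.
have [nMA /andP[Ob1 Mb2] /andP[Oc1 Oc2]] := rainbow_area cola colb colc OA.
split; first by case: areaE (nMA : A \notin M) => -> //; apply: contra; exact: maxiN.
apply/rainbowP; exists a, b, c; rewrite -!residues_chart /residues.
move: cola colb colc.
case: flag_colourP => // Ma1 Ma2 _; case: flag_colourP => // nMb1 _ _.
case: flag_colourP => // nMc2 _ _; rewrite /residue_of Ma1 Ma2 Mb2.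
rewrite (negbTE nMb1) (negbTE nMc2).
by split=> //; repeat case: ifP => _.
Qed.

Definition rainbow_flags (P : 'I_3 -> K * K) :=
  count (fun f => rainbow (fun k => flag_colour (chart f (P k)))) flags.

(** Transfers the count on residues to the valuation ring; in the extremal case
the vertices are congruent to corners of the square, and so is the area to that
of the corners. *)
Lemma rainbow_flags_bound (P : 'I_3 -> K * K) :
  dbl_area (P 0) (P 1) (P 2) \in O ->
  (rainbow_flags P <= 4)%N /\
  (rainbow_flags P = 4%N ->
     dbl_area (P 0) (P 1) (P 2) - 1 \in M \/ dbl_area (P 0) (P 1) (P 2) + 1 \in M).
Proof.
move=> Oarea.
pose p k := residues (P k).
pose v := count (fun f =>
  rainbow (fun k => residue_colour (residue_chart f (p k)))) flags.
have le_v : (rainbow_flags P <= v)%N.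
  by apply: sub_count => f /(rainbow_residues Oarea)[].
have [le4 eq4] : (v <= 4)%N /\ (v = 4%N -> corner_triangle p).
  exact: residue_flags.
split=> [|four]; first exact: leq_trans le_v le4.
have v4 : v = 4%N by apply/eqP; rewrite eqn_leq le4 -four.
have [xs area1] := eq4 v4.
pose e k : K * K := ((residue_int (p k).1)%:~R, (residue_int (p k).2)%:~R).
have congr1 k : (P k).1 - (e k).1 \in M.
  have := (xs k).1; rewrite /e /p /residues /= /residue_of; case: ifP => [Mx _|_].
    by rewrite subr0.
  by case: ifP => // M1x _; rewrite /= -opprB maxiN.
have congr2 k : (P k).2 - (e k).2 \in M.
  have := (xs k).2; rewrite /e /p /residues /= /residue_of; case: ifP => [Mx _|_].
    by rewrite subr0.
  by case: ifP => // M1x _; rewrite /= -opprB maxiN.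
have Me k : (e k).1 \in O /\ (e k).2 \in O.
  have Oint r : (residue_int r)%:~R \in O by case: r; [exact: val0|exact: val1|exact: val0].
  by split; exact: Oint.
(* The determinant is a polynomial in the coordinates, hence respects
   congruences modulo [M]. *)
have Marea : dbl_area (P 0) (P 1) (P 2) - dbl_area (e 0) (e 1) (e 2) \in M.
  pose d k := ((P k).1 - (e k).1, (P k).2 - (e k).2).
  have Pd k : P k = ((e k).1 + (d k).1, (e k).2 + (d k).2).
    by rewrite /d /= ![_ + (_ - _)]addrC !subrK -surjective_pairing.
  have -> : dbl_area (P 0) (P 1) (P 2) - dbl_area (e 0) (e 1) (e 2) =
      ((d 1).1 - (d 0).1) * ((P 2).2 - (P 0).2)
      + ((e 1).1 - (e 0).1) * ((d 2).2 - (d 0).2)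
      - (((d 2).1 - (d 0).1) * ((P 1).2 - (P 0).2)
         + ((e 2).1 - (e 0).1) * ((d 1).2 - (d 0).2)).
    by rewrite /dbl_area !Pd /=; ring.
  have OP k : (P k).2 \in O.
    by rewrite -[(P k).2](subrK (e k).2) valD ?(Me k).2 // maxi_val.
  have d1 k : (d k).1 \in M by exact: congr1.
  have d2 k : (d k).2 \in M by exact: congr2.
  have e1 k : (e k).1 \in O := (Me k).1.
  by apply: maxiB; apply: maxiD;
    [apply: maxiMr|apply: maxiMl|apply: maxiMr|apply: maxiMl];
    first [exact: maxiB | exact: valB].
have : dbl_area (e 0) (e 1) (e 2) = 1 \/ dbl_area (e 0) (e 1) (e 2) = -1.
  have -> : dbl_area (e 0) (e 1) (e 2) =
      (dbl_area (residue_int (p 0).1, residue_int (p 0).2)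
         (residue_int (p 1).1, residue_int (p 1).2)
         (residue_int (p 2).1, residue_int (p 2).2))%:~R.
    by rewrite /dbl_area /e /= !(intrB, intrM).
  by case: area1 => ->; [left|right].
by case=> areae; rewrite areae ?opprK in Marea; [left|right].
Qed.

End Reduction.

(** The corners in the cyclic order (0, 0), (1, 0), (1, 1), (0, 1). *)
Definition unit_square (K : fieldType) (k : 'I_4) : K * K :=
  ((k \in [:: 1; 2])%:R, (k \in [:: 2; 3])%:R).

(** The only edge of the square with colours [Corner] and [Side] is the side of
the flag itself; the two remaining corners are off the side. *)
Lemma unit_square_colour (K : fieldType) (O : {pred K}) f : valuation_ring O ->
  \sum_k colour_step (flag_colour O (chart f (unit_square K k)))
                     (flag_colour O (chart f (unit_square K (ordS k)))) != 0.
Proof.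
move=> valO.
pose col (b : bool * bool) := if b.2 then Off else if b.1 then Side else Corner.
have colE (b1 b2 : bool) : flag_colour O (b1%:R, b2%:R) = col (b1, b2).
  have [[M0 M1] O1] := (maxi0 valO, negbTE (maxi1 valO), val1 valO).
  by rewrite /flag_colour /col /=; case: b1; case: b2;
    rewrite /= ?mulr1n ?mulr0n ?M0 ?M1 ?invr1 ?mulr1 ?(val0 valO) ?O1.
pose ch (f : bool * bool * bool) (b : bool * bool) :=
  let: (sw, fx, fy) := f in
  let x := fx (+) b.1 in let y := fy (+) b.2 in if sw then (y, x) else (x, y).
have chE f' (b1 b2 : bool) : chart f' (b1%:R : K, b2%:R) = 
    ((ch f' (b1, b2)).1%:R, (ch f' (b1, b2)).2%:R).
  have flipE (b : bool) : 1 - b%:R = (~~ b)%:R :> K.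
    by case: b; rewrite ?subr0 ?subrr.
  by case: f' => [[[] []] []]; rewrite /chart /ch /= ?flipE.
under eq_bigr do rewrite /unit_square !chE !colE -!surjective_pairing.
by rewrite !big_ord_recl big_ord0; case: f => [[[] []] []]; vm_compute.
Qed.

(** * Sums over the edges of a triangulation *)

Section EdgeSums.
Variables (R : realType) (m n : nat) (T : square_triangulation R m n).

Definition edges : {set 'I_m * 'I_m} :=
  [set (triangle T x.1 x.2, triangle T x.1 (ordS x.2)) | x in {: 'I_n * 'I_3}].

Lemma edgesP u v : reflect (directed_edge (triangle T) u v) ((u, v) \in edges).
Proof.
apply: (iffP imsetP) => [[[i k] _ [-> ->]]|[i [k [<- <-]]]]; first by exists i, k.
by exists (i, k).
Qed.

Lemma edges_irrefl u : (u, u) \notin edges.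
Proof.
apply/edgesP => -[i [k [Ek Eu]]].
have := @triangle_inj _ _ _ T i k (ordS k); rewrite Ek Eu => /(_ erefl) /eqP.
by case: k {Ek Eu} => [[|[|[|//]]] ?].
Qed.

Lemma triangle_edge_inj :
  injective (fun x : 'I_n * 'I_3 => (triangle T x.1 x.2, triangle T x.1 (ordS x.2))).
Proof.
move=> [i k] [j l] /= [Ek El]; have Eij := coherent Ek El.
by rewrite -Eij in Ek *; rewrite (triangle_inj Ek).
Qed.

Lemma boundary_edges : [set e in edges | (e.2, e.1) \notin edges] =
  [set (corner T k, corner T (ordS k)) | k in 'I_4].
Proof.
apply/setP => -[u v]; rewrite inE /=.
apply/andP/imsetP => [[/edgesP uv /edgesP vu]|[k _ [-> ->]]].
  by have /(boundaryP T)[k [-> ->]] : boundary_edge (triangle T) u v; [|exists k].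
have [/edgesP uv vu] : boundary_edge (triangle T) (corner T k) (corner T (ordS k)).
  by apply/(boundaryP T); exists k.
by split=> //; apply/edgesP.
Qed.

(** Stokes' formula: by coherence a directed edge lies in at most one triangle,
and the two directions of an inner edge cancel. *)
Lemma boundary_sum (V : zmodType) (g : 'I_m -> 'I_m -> V) :
  (forall u v, g u v + g v u = 0) ->
  \sum_i \sum_k g (triangle T i k) (triangle T i (ordS k)) =
  \sum_k g (corner T k) (corner T (ordS k)).
Proof.
move=> gC; pose h (e : 'I_m * 'I_m) := g e.1 e.2.
rewrite pair_bigA /= -(big_imset h (in2W triangle_edge_inj)) /=.
rewrite (bigID (fun e => (e.2, e.1) \in edges)) /= [X in X + _](_ : _ = 0) ?add0r.
  transitivity (\sum_(e in [set e in edges | (e.2, e.1) \notin edges]) h e).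
    by apply: eq_bigl => e; rewrite inE.
  rewrite boundary_edges big_imset //= => k l _ _ [Ek _].
  exact: (corner_inj Ek).
pose swap (e : 'I_m * 'I_m) := (e.2, e.1).
have swapK : involutive swap by case.
rewrite (bigID (fun e : 'I_m * 'I_m => e.1 < e.2)%N) /=.
rewrite [X in _ + X](reindex_inj (inv_inj swapK)) /=.
rewrite [X in _ + X](eq_bigl (fun e : 'I_m * 'I_m =>
  (e \in edges) && ((e.2, e.1) \in edges) && (e.1 < e.2)%N)).
  by rewrite -big_split big1 // => e _; exact: gC.
case=> u v /=; rewrite -leqNgt leq_eqVlt [X in X && _]andbC.
by case: eqP => // /val_inj ->; rewrite (negbTE (edges_irrefl v)).
Qed.

(** The factor 2 is due to [dbl_area] at three corners being already the area of
the whole parallelogram. *)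
Lemma area_sum (A : comNzRingType) (z : 'I_m -> A * A) :
  z (corner T 0) + z (corner T 2) = z (corner T 1) + z (corner T 3) ->
  \sum_i dbl_area (z (triangle T i 0)) (z (triangle T i 1)) (z (triangle T i 2)) =
  2 * dbl_area (z (corner T 0)) (z (corner T 1)) (z (corner T 3)).
Proof.
move=> para; pose g u v := (z u).1 * (z v).2 - (z v).1 * (z u).2.
have gC u v : g u v + g v u = 0 by rewrite /g; ring.
transitivity (\sum_i \sum_k g (triangle T i k) (triangle T i (ordS k))).
  apply: eq_bigr => i _; rewrite !big_ord_recl big_ord0.
  have -> : ordS (0 : 'I_3) = 1 by exact: val_inj.
  have -> : lift ord0 ord0 = 1 :> 'I_3 by exact: val_inj.
  have -> : ordS (1 : 'I_3) = 2 by exact: val_inj.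
  have -> : lift ord0 (lift ord0 ord0) = 2 :> 'I_3 by exact: val_inj.
  have -> : ordS (2 : 'I_3) = 0 by exact: val_inj.
  by rewrite /dbl_area /g; ring.
rewrite (boundary_sum gC) !big_ord_recl big_ord0.
have -> : ordS (0 : 'I_4) = 1 by exact: val_inj.
have -> : lift ord0 ord0 = 1 :> 'I_4 by exact: val_inj.
have -> : ordS (1 : 'I_4) = 2 by exact: val_inj.
have -> : lift ord0 (lift ord0 ord0) = 2 :> 'I_4 by exact: val_inj.
have -> : ordS (2 : 'I_4) = 3 by exact: val_inj.
have -> : lift ord0 (lift ord0 (lift ord0 ord0)) = 3 :> 'I_4 by exact: val_inj.
have -> : ordS (3 : 'I_4) = 0 by exact: val_inj.
have z2 : z (corner T 2) = z (corner T 1) + z (corner T 3) - z (corner T 0).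
  by rewrite -para addrAC subrr add0r.
by rewrite /g z2 /dbl_area /=; ring.
Qed.

(** Sperner's lemma: the sum over the boundary is the sum of the contributions of
the triangles, so one of these is nonzero. *)
Lemma exists_rainbow (c : 'I_m -> colour) :
  \sum_k colour_step (c (corner T k)) (c (corner T (ordS k))) != 0 ->
  exists i, rainbow (fun k => c (triangle T i k)).
Proof.
rewrite -(boundary_sum (g := fun u v => colour_step (c u) (c v))) => [|u v].
  move=> sum0; apply/existsP; apply: contraNT sum0 => /existsPn no.
  by rewrite big1 // => i _; have /negPn/eqP := no i.
by case: (c u); case: (c v).
Qed.

(** Each of the eight flags needs a three-coloured triangle, only two triangles
are large enough, and neither serves more than four flags. *)
Lemma two_big_triangles (K : fieldType) (O : {pred K}) (z : 'I_m -> K * K)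
    (i j : 'I_n) :
  let D k := dbl_area (z (triangle T k 0)) (z (triangle T k 1))
    (z (triangle T k 2)) in
  valuation_ring O -> (forall k, z (corner T k) = unit_square K k) ->
  D i \in O -> D j \in O ->
  (forall k, k != i -> k != j -> D k \in maximal_ideal O) ->
  (D i - 1 \in maximal_ideal O \/ D i + 1 \in maximal_ideal O) /\
  (D j - 1 \in maximal_ideal O \/ D j + 1 \in maximal_ideal O).
Proof.
move=> D valO zcorner Oi Oj small.
pose P k l := z (triangle T k l).
have [lei eqi] := rainbow_flags_bound valO (P := P i) Oi.
have [lej eqj] := rainbow_flags_bound valO (P := P j) Oj.
suff ge8 : (8 <= rainbow_flags O (P i) + rainbow_flags O (P j))%N.
  split; [apply: eqi|apply: eqj]; apply/eqP; rewrite eqn_leq ?lei ?lej /=.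
    by rewrite -(leq_add2r 4); apply: leq_trans ge8 _; rewrite leq_add2l.
  by rewrite -(leq_add2l 4); apply: leq_trans ge8 _; rewrite leq_add2r.
pose vis k f := rainbow (fun l => flag_colour O (chart f (P k l))).
rewrite -[8%N]/(size flags) /rainbow_flags -count_predUI -[X in (X <= _)%N]addn0.
apply: leq_add => //; rewrite -[X in (X <= _)%N](count_predT flags).
apply: sub_count => f _ /=.
have := unit_square_colour f valO.
have -> : \sum_k colour_step (flag_colour O (chart f (unit_square K k)))
      (flag_colour O (chart f (unit_square K (ordS k)))) =
    \sum_k colour_step (flag_colour O (chart f (z (corner T k))))
      (flag_colour O (chart f (z (corner T (ordS k))))).
  by apply: eq_bigr => k _; rewrite !zcorner.
move=> /(exists_rainbow (c := fun v => flag_colour O (chart f (z v))))[k vk].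
have [ki|nki] := eqVneq k i; first by rewrite -ki vk.
have [kj|nkj] := eqVneq k j; first by rewrite -kj vk orbT.
have Mk := small k nki nkj.
by have [/negP[]] := rainbow_residues valO (P := P k) (maxi_val Mk) vk.
Qed.

End EdgeSums.

(** * Evaluation of homogeneous polynomials *)

Section Specialization.

Lemma mmap_comp n (A B : nzRingType) (C : nzRingType) (g : {rmorphism B -> C})
    (f : A -> B) (h : 'I_n -> B) (p : {mpoly A[n]}) :
  g (mmap f h p) = mmap (g \o f) (g \o h) p.
Proof.
rewrite /mmap rmorph_sum; apply: eq_bigr => mu _ /=.
rewrite rmorphM; congr (_ * _); rewrite /mmap1 rmorph_prod.
by apply: eq_bigr => i _; rewrite rmorphXn.
Qed.

Lemma mmap_ext n (A B : nzRingType) (f f' : A -> B) (h h' : 'I_n -> B)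
    (p : {mpoly A[n]}) : f =1 f' -> h =1 h' -> mmap f h p = mmap f' h' p.
Proof.
move=> ff hh; rewrite /mmap; apply: eq_bigr => mu _.
by rewrite ff (mmap1_eq _ hh).
Qed.

Lemma mmapXU n (A : nzRingType) (B : nzRingType) (f : {rmorphism A -> B})
    (h : 'I_n -> B) i : mmap f h 'X_i = h i.
Proof. by rewrite mmapX mmap1U. Qed.

Definition homogenize n (A : comNzRingType) (p : {mpoly A[n]}) : {mpoly A[n]} :=
  \sum_(mu <- msupp p)
    p@_mu *: ('X_[mu] * (\sum_i 'X_i) ^+ (msize p - mdeg mu)).

Lemma sum_dhomog n (A : comNzRingType) : \sum_i ('X_i : {mpoly A[n]}) \is 1.-homog.
Proof. by apply: rpred_sum => i _; rewrite dhomogX /= mdeg1. Qed.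

Lemma homogenize_dhomog n (A : comNzRingType) (p : {mpoly A[n]}) :
  homogenize p \is (msize p).-homog.
Proof.
rewrite /homogenize big_seq; apply: rpred_sum => mu mup; apply: dhomogZ.
have -> : msize p = (mdeg mu + 1 * (msize p - mdeg mu))%N.
  by rewrite mul1n subnKC // ltnW // msize_mdeg_lt.
apply: dhomogM; first by rewrite dhomogX.
by rewrite mul1n addKn -[X in X.-homog]mul1n; apply/dhomogMn/sum_dhomog.
Qed.

(** The sum of the variables serves as homogenizing variable, so that
dehomogenizing is division by the sum of the coordinates. *)
Lemma homogenize_eval n (A : comNzRingType) (F : fieldType) (f : {rmorphism A -> F})
    (v : 'I_n -> F) (p : {mpoly A[n]}) : let s := \sum_i v i in s != 0 ->
  mmap f v (homogenize p) = s ^+ msize p * mmap f (fun i => v i / s) p.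
Proof.
move=> s s0; rewrite /homogenize raddf_sum [in RHS]/mmap mulr_sumr /=.
rewrite big_seq [in RHS]big_seq; apply: eq_bigr => mu mup.
rewrite mmapZ rmorphM rmorphXn raddf_sum /= mmapX.
under eq_bigr do rewrite mmapXU.
rewrite -/s [RHS]mulrCA; congr (_ * _).
have -> : mmap1 (fun i => v i / s) mu = mmap1 v mu / s ^+ mdeg mu.
  rewrite /mmap1 mdegE -prodrXr -prodf_div.
  by apply: eq_bigr => i _; rewrite expr_div_n.
rewrite [RHS]mulrCA; congr (_ * _).
by rewrite -{2}(subnK (ltnW (msize_mdeg_lt mup))) exprD mulfK // expf_neq0.
Qed.

End Specialization.

(** * Affine coordinates and areas *)

Lemma det_dbl_area (A : comNzRingType) (P : 'I_3 -> A * A) :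
  \det (\matrix_(a < 3, b < 3)
    (if a == 0 then 1 else if a == 1 then (P b).1 else (P b).2)) =
  dbl_area (P 0) (P 1) (P 2).
Proof.
rewrite (expand_det_row _ 0) !big_ord_recl big_ord0 /cofactor.
rewrite !(expand_det_row _ 0) !big_ord_recl !big_ord0 /cofactor !det_mx11 !mxE /=.
have [Q PE] : exists Q : nat -> A * A, forall i, P i = Q i.
  by exists (fun k => P (inord k)) => i; rewrite inord_val.
rewrite /dbl_area !PE /= /bump /= !addn0 !addn1 !modn_small //.
by ring.
Qed.

Lemma areaE (R : realType) (P : 'I_3 -> R[i]%C * R[i]%C) :
  area P = 2^-1 * dbl_area (P 0) (P 1) (P 2).
Proof. by rewrite /area det_dbl_area. Qed.

Section AffineCoordinates.
Variables (F : fieldType) (p q s : F * F).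

(** The coordinates of [v] in the affine frame with origin [p] and unit points
[q] and [s], by Cramer's rule. *)
Definition affine_coord (v : F * F) : F * F :=
  (dbl_area p v s / dbl_area p q s, dbl_area p q v / dbl_area p q s).

Hypothesis pqs_neq0 : dbl_area p q s != 0.

Lemma affine_coord_corners :
  [/\ affine_coord p = (0, 0), affine_coord q = (1, 0),
      affine_coord (q + s - p) = (1, 1) & affine_coord s = (0, 1)].
Proof.
split; congr (_, _); apply: (mulIf pqs_neq0); rewrite divfK // ?mul0r ?mul1r //;
  by rewrite /dbl_area /=; ring.
Qed.

Lemma dbl_area_affine_coord (u v w : F * F) :
  dbl_area (affine_coord u) (affine_coord v) (affine_coord w) =
  dbl_area u v w / dbl_area p q s.
Proof.
apply: (mulIf pqs_neq0); apply: (mulIf pqs_neq0); rewrite divfK //.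
rewrite {1}/dbl_area /=; move: pqs_neq0; set d := dbl_area p q s => d0.
transitivity ((dbl_area p v s - dbl_area p u s) * (dbl_area p q w - dbl_area p q u)
  - (dbl_area p w s - dbl_area p u s) * (dbl_area p q v - dbl_area p q u)).
  by field.
by rewrite /d /dbl_area; ring.
Qed.

End AffineCoordinates.

Lemma affine_coord_unit_square (F : fieldType) (c : 'I_4 -> F * F) :
  c 0 + c 2 = c 1 + c 3 -> dbl_area (c 0) (c 1) (c 3) != 0 ->
  forall k, affine_coord (c 0) (c 1) (c 3) (c k) = unit_square F k.
Proof.
move=> para c0 k; have [w0 w1 w2 w3] := affine_coord_corners c0.
have c2 : c 2 = c 1 + c 3 - c 0 by rewrite -para addrAC subrr add0r.
rewrite -c2 in w2; case: k => [[|[|[|[|//]]]] ltk].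
- by have -> : Ordinal ltk = 0 by exact: val_inj.
- by have -> : Ordinal ltk = 1 by exact: val_inj.
- by have -> : Ordinal ltk = 2 by exact: val_inj.
- by have -> : Ordinal ltk = 3 by exact: val_inj.
Qed.

Lemma mul_half_div (F : fieldType) (x y : F) : (2 : F) != 0 ->
  2 * (2^-1 * x / y) = x / y.
Proof. by move=> two0; rewrite -mulrA mulVKf. Qed.

(** * Degenerating the generic drawing *)

Section GenericDrawing.
Variables (R : realType) (m n : nat) (T : square_triangulation R m n).
Let C : numClosedFieldType := R[i]%C.
Let S := {mpoly C[m + m]}.
Let L := {fraction S}.

(** The first [m] indeterminates are the first coordinates of the vertices, the
others the second coordinates.  The last corner is determined by the other
three, so its own two indeterminates do not occur. *)
Definition generic_drawing (v : 'I_m) : S * S :=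
  let X v := ('X_(lshift m v), 'X_(rshift m v)) in
  if v == corner T 3 then X (corner T 0) + X (corner T 2) - X (corner T 1)
  else X v.

Definition specialize (rho : 'I_m -> C * C) : S -> C :=
  meval (fun k => match split k with inl v => (rho v).1 | inr v => (rho v).2 end).

Lemma specialize_generic (rho : 'I_m -> C * C) v : drawing T rho ->
  (specialize rho (generic_drawing v).1, specialize rho (generic_drawing v).2) = rho v.
Proof.
move=> para; have lE w : specialize rho 'X_(lshift m w) = (rho w).1.
  by rewrite /specialize mevalXU (unsplitK (inl w)).
have rE w : specialize rho 'X_(rshift m w) = (rho w).2.
  by rewrite /specialize mevalXU (unsplitK (inr w)).
rewrite /generic_drawing; case: eqP => [->|_] /=; last first.
  by rewrite lE rE -surjective_pairing.
rewrite /specialize !(mevalD, mevalN) -/(specialize rho) !lE !rE.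
have -> : rho (corner T 3) = rho (corner T 0) + rho (corner T 2) - rho (corner T 1).
  by rewrite para addrAC subrr add0r.
by rewrite [RHS]surjective_pairing.
Qed.

Definition generic_area (k : 'I_n) : S :=
  (2^-1)%:MP * dbl_area (generic_drawing (triangle T k 0))
    (generic_drawing (triangle T k 1)) (generic_drawing (triangle T k 2)).

Lemma specialize_area (rho : 'I_m -> C * C) k : drawing T rho ->
  specialize rho (generic_area k) = area_map T rho k.
Proof.
move=> para; rewrite /area_map areaE /generic_area /= -!(specialize_generic _ para).
by rewrite /specialize /dbl_area !(mevalM, mevalD, mevalN, mevalC) /=.
Qed.

Definition constant (c : C) : L := FracField.tofrac (c%:MP : S).
HB.instance Definition _ := GRing.RMorphism.copy constant
  (@FracField.tofrac S \o @mpolyC (m + m) C).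

(** A relation between the generic areas holds for the areas of every drawing,
hence on the closure of their image. *)
Lemma homogeneous_relation (a : 'I_n -> C) d (H : {mpoly C[n]}) :
  area_variety T a -> H \is d.-homog ->
  mmap constant (fun k => FracField.tofrac (generic_area k)) H = 0 -> H.@[a] = 0.
Proof.
move=> [_ Va] homH H0; apply: (Va d) => // b [_ [rho para ->]].
have {H0} : mmap (@mpolyC (m + m) C) generic_area H = 0.
  apply/eqP; rewrite -tofrac_eq0 mmap_comp; exact/eqP.
move=> /(congr1 (specialize rho)); rewrite /specialize meval0 mmap_comp.
rewrite /meval => <-; apply: mmap_ext => [c|k] /=.
  by rewrite mevalC.
by rewrite -(specialize_area k para).
Qed.

Definition total_area : L := \sum_k FracField.tofrac (generic_area k).

Definition area_ratio (k : 'I_n) : L := FracField.tofrac (generic_area k) / total_area.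

Section Point.
Variables (a : 'I_n -> C) (Va : area_variety T a).
Let s := \sum_k a k.
Hypothesis s_neq0 : s != 0.

Lemma total_area_neq0 : total_area != 0.
Proof.
apply: contraNneq s_neq0 => sigma0.
have := homogeneous_relation Va (sum_dhomog n C).
rewrite !raddf_sum /=; under eq_bigr do rewrite mmapXU.
move=> /(_ sigma0); under eq_bigr do rewrite mevalXU.
by move=> s0; apply/eqP.
Qed.

(** This makes [area_ratio k |-> a k / s] a well-defined map. *)
Lemma area_ratio_relation (G : {mpoly C[n]}) :
  mmap constant area_ratio G = 0 -> G.@[fun k => a k / s] = 0.
Proof.
move=> G0; have := homogeneous_relation Va (homogenize_dhomog G).
rewrite homogenize_eval ?total_area_neq0 // -/area_ratio G0 mulr0 => /(_ erefl).
rewrite /meval homogenize_eval // => /eqP.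
by rewrite mulf_eq0 expf_eq0 (negbTE s_neq0) andbF /= => /eqP.
Qed.

(** The subring consists of the polynomials in the area ratios with complex
coefficients, and the ideal of those that vanish at [a / s]. *)
Lemma specialization_valuation : exists O : {pred L},
  [/\ valuation_ring O, forall c, constant c \in O,
      forall k, area_ratio k \in O &
      forall k, area_ratio k - constant (a k / s) \in maximal_ideal O].
Proof.
pose at_a (G : {mpoly C[n]}) := G.@[fun k => a k / s].
pose X0 : set (L * bool) := [set yb | exists2 G : {mpoly C[n]},
  yb.1 = mmap constant area_ratio G & yb.2 = false -> at_a G = 0]%classic.
have pX0 : proper_ideal X0.
  split; first split.
  - by exists 1; rewrite ?rmorph1.
  - by exists 0; rewrite ?raddf0 // => _; exact: meval0.
  - by move=> x [G /= -> _]; exists G.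
  - move=> x y b [G /= -> G0] [H /= -> H0]; exists (G - H).
      by rewrite rmorphB.
    by move=> /= bE; rewrite /at_a mevalB [X in X - _]G0 // [X in _ - X]H0 // subrr.
  - move=> x y b c [G /= -> G0] [H /= -> H0]; exists (G * H).
      by rewrite rmorphM.
    move=> /= /negbT; rewrite negb_and => bc; rewrite /at_a mevalM.
    by case/orP: bc => /negbTE; [move/G0|move/H0]; rewrite /at_a => ->; rewrite ?mul0r ?mulr0.
  - case=> G /= G1 /(_ erefl) G0.
    have := @area_ratio_relation (G - 1); rewrite rmorphB rmorph1 /= -G1 subrr => /(_ erefl).
    rewrite mevalB meval1 [X in X - _]G0 sub0r => /eqP.
    by rewrite oppr_eq0 oner_eq0.
have [O [valO OX MX]] := dominating_valuation_ring pX0.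
exists O; split=> // [c|k|k].
- by apply: OX; exists c%:MP; rewrite //= mmapC.
- by apply: OX; exists 'X_k; rewrite //= mmapXU.
- apply: MX; exists ('X_k - (a k / s)%:MP); first by rewrite /= rmorphB /= mmapXU mmapC.
  by move=> _; rewrite /at_a mevalB mevalXU mevalC subrr.
Qed.

End Point.

(** The case where one of the two coordinates vanishes is included; it shows
that such a point is not on the variety at all. *)
Lemma two_areas (i j : 'I_n) (a : 'I_n -> C) : i != j -> area_variety T a ->
  (forall k, k != i -> k != j -> a k = 0) ->
  a i + a j = 0 \/ (a i = a j).
Proof.
move=> ij Va a0.
have sE : \sum_k a k = a i + a j.
  rewrite (bigD1 i) //= (bigD1 j) 1?eq_sym //= big1 ?addr0 // => k /andP[ki kj].
  exact: a0.
have [s0|s0] := eqVneq (a i + a j) 0; [by left|right].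
rewrite -sE in s0; have [O [valO Oc Or Mr]] := specialization_valuation Va s0.
have sig0 := total_area_neq0 Va s0.
pose z w : L * L := (FracField.tofrac (generic_drawing w).1,
                     FracField.tofrac (generic_drawing w).2).
have two0 : (2 : L) != 0.
  by rewrite -(rmorph_nat constant 2) fmorph_eq0 pnatr_eq0.
have para : z (corner T 0) + z (corner T 2) = z (corner T 1) + z (corner T 3).
  have [E02 E12] : corner T 0 != corner T 3 /\ corner T 2 != corner T 3.
    by split; apply/negP => /eqP /corner_inj.
  have E1 : corner T 1 != corner T 3 by apply/negP => /eqP /corner_inj.
  rewrite /z /generic_drawing (negbTE E02) (negbTE E12) (negbTE E1) eqxx /=.
  by congr (_, _); rewrite /= ?rmorphB ?rmorphD /=; ring.
have areaL k : FracField.tofrac (generic_area k) = 2^-1 *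
    dbl_area (z (triangle T k 0)) (z (triangle T k 1)) (z (triangle T k 2)).
  rewrite /generic_area rmorphM /= -[FracField.tofrac _%:MP]/(constant _).
  rewrite fmorphV rmorph_nat; congr (_ * _).
  by rewrite /dbl_area /z /= !(rmorphB, rmorphM).
have sigE : total_area = dbl_area (z (corner T 0)) (z (corner T 1)) (z (corner T 3)).
  rewrite /total_area; under eq_bigr do rewrite areaL.
  by rewrite -mulr_sumr area_sum // mulKf.
rewrite sigE in sig0.
pose w v := affine_coord (z (corner T 0)) (z (corner T 1)) (z (corner T 3)) (z v).
have wcorner k : w (corner T k) = unit_square L k.
  exact: (affine_coord_unit_square (c := fun k => z (corner T k)) para sig0).
pose D k := dbl_area (w (triangle T k 0)) (w (triangle T k 1)) (w (triangle T k 2)).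
have DE k : D k = 2 * area_ratio k.
  rewrite /area_ratio areaL sigE (mul_half_div _ _ two0).
  exact: (dbl_area_affine_coord sig0).
have OD k : D k \in O by rewrite DE -(rmorph_nat constant) valM.
have MD k : D k - constant (2 * (a k / \sum_l a l)) \in maximal_ideal O.
  rewrite DE rmorphM /= rmorph_nat -mulrBr -(rmorph_nat constant).
  by rewrite maxiMl.
have small k : k != i -> k != j -> D k \in maximal_ideal O.
  move=> ki kj; have := MD k; rewrite a0 // mul0r mulr0.
  by rewrite (_ : constant 0 = 0) ?subr0 //; exact: rmorph0.
have constM c : constant c \in maximal_ideal O -> c = 0.
  move=> Mc; apply/eqP; apply: contraT => c0.
  have := maxiMl valO (Oc c^-1) Mc.
  by rewrite -rmorphM /= mulVf // rmorph1 (negbTE (maxi1 valO)).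
have unitD k : D k - 1 \in maximal_ideal O \/ D k + 1 \in maximal_ideal O ->
    2 * a k = \sum_l a l \/ 2 * a k = - \sum_l a l.
  case=> Mk; [left|right].
    have := maxiB valO Mk (MD k).
    have -> : forall x y : L, x - 1 - (x - y) = y - 1 by move=> x y; ring.
    rewrite -(rmorph1 constant) -rmorphB => /constM /eqP.
    by rewrite subr_eq0 mulrA => /eqP E; rewrite -[LHS](divfK s0) E mul1r.
  have := maxiB valO Mk (MD k).
  have -> : forall x y : L, x + 1 - (x - y) = y + 1 by move=> x y; ring.
  rewrite -(rmorph1 constant) -rmorphD => /constM /eqP.
  by rewrite addr_eq0 mulrA => /eqP E; rewrite -[LHS](divfK s0) E mulN1r.
have [/unitD Ei /unitD Ej] := two_big_triangles valO wcorner (OD i) (OD j) small.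
have C2 : (2 : C) != 0 by rewrite pnatr_eq0.
have sum2 : 2 * a i + 2 * a j = 2 * \sum_l a l by rewrite sE mulrDr.
case: Ei Ej sum2 => Ei [] Ej; rewrite Ei Ej.
- by move=> _; apply: (mulfI C2); rewrite Ei Ej.
- by rewrite subrr => /esym/eqP; rewrite mulf_eq0 (negbTE C2) (negbTE s0).
- by rewrite addNr => /esym/eqP; rewrite mulf_eq0 (negbTE C2) (negbTE s0).
move=> /eqP; rewrite -subr_eq0.
have -> : forall x : C, - x - x - 2 * x = - (4 * x) by move=> x; ring.
by rewrite oppr_eq0 mulf_eq0 pnatr_eq0 (negbTE s0).
Qed.

End GenericDrawing.

(** * The binary forms of the area polynomial *)

Section BinaryForms.
Variables (n : nat) (i j : 'I_n).
Implicit Types (q : {poly int}) (p : {mpoly int[n]}) (d : nat).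

(** Homogenization in degree [d], with [X] becoming [X_i / X_j]. *)
Definition binary_form d q : {mpoly int[n]} :=
  \sum_(k < d.+1) q`_k *: ('X_i ^+ k * 'X_j ^+ (d - k)).

Lemma binary_form_sum d (I : Type) (r : seq I) (P : pred I) (F : I -> {poly int}) :
  binary_form d (\sum_(l <- r | P l) F l) = \sum_(l <- r | P l) binary_form d (F l).
Proof.
rewrite /binary_form exchange_big; apply: eq_bigr => k _.
by rewrite coef_sum scaler_suml.
Qed.

Lemma binary_formZ d c q : binary_form d (c *: q) = c *: binary_form d q.
Proof.
rewrite /binary_form scaler_sumr; apply: eq_bigr => k _.
by rewrite coefZ scalerA.
Qed.

Lemma binary_formXn d k : (k <= d)%N ->
  binary_form d 'X^k = 'X_i ^+ k * 'X_j ^+ (d - k).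
Proof.
move=> lekd; rewrite /binary_form (bigD1 (Ordinal (lekd : (k < d.+1)%N))) //=.
rewrite coefXn eqxx scale1r big1 ?addr0 // => l /eqP nl.
by rewrite coefXn; case: eqP => [lk|_]; [case: nl; exact: val_inj|rewrite scale0r].
Qed.

Lemma binary_form_linear_factor d q (z : int) : (size q <= d.+1)%N ->
  binary_form d.+1 (q * ('X - z%:P)) = binary_form d q * ('X_i - z *: 'X_j).
Proof.
move=> sq; rewrite mulrBr [q * z%:P]mulrC mul_polyC.
have -> : binary_form d.+1 (q * 'X - z *: q) =
    binary_form d.+1 (q * 'X) - z *: binary_form d.+1 q.
  rewrite -binary_formZ /binary_form -sumrB.
  by apply: eq_bigr => k _; rewrite coefB scalerBl.
rewrite mulrBr; congr (_ - _).
  rewrite /binary_form big_ord_recl coefMX scale0r add0r mulr_suml.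
  apply: eq_bigr => k _; rewrite coefMX /= /bump /= add1n subSS -scalerAl.
  by rewrite exprSr -!mulrA ['X_i * _]mulrC.
rewrite -scalerAr; congr (_ *: _).
rewrite /binary_form big_ord_recr /= nth_default // scale0r addr0 mulr_suml.
apply: eq_bigr => k _; rewrite -scalerAl subSn; last by rewrite -ltnS.
by rewrite exprSr mulrA.
Qed.

Lemma binary_form_prod (rs : seq int) :
  binary_form (size rs) (\prod_(z <- rs) ('X - z%:P)) =
  \prod_(z <- rs) ('X_i - z *: 'X_j).
Proof.
elim: rs => [|z rs IH].
  by rewrite !big_nil -(expr0 'X) binary_formXn // !expr0 mulr1.
rewrite !big_cons /= mulrC binary_form_linear_factor ?IH 1?mulrC //.
by rewrite size_prod_XsubC.
Qed.

Lemma prod_pm1 (rs : seq int) : {in rs, forall z, z = 1 \/ z = -1} ->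
  \prod_(z <- rs) ('X_i - z *: 'X_j) =
  ('X_i + 'X_j) ^+ count_mem (-1) rs * ('X_i - 'X_j) ^+ count_mem 1 rs
  :> {mpoly int[n]}.
Proof.
elim: rs => [|z rs IH] zrs; first by rewrite big_nil mulr1.
rewrite big_cons IH => [|y yrs]; last by apply: zrs; rewrite inE yrs orbT.
have [->|->] := zrs z (mem_head _ _).
  by rewrite /= add0n add1n scale1r exprS mulrCA.
by rewrite /= add0n add1n scaleN1r opprK exprS mulrA.
Qed.

(** A monomial of degree [d] survives exactly when its exponents at [i] and [j]
already add up to [d]. *)
Lemma restrict_to_pairE d p : i != j -> p \is d.-homog ->
  restrict_to_pair i j p =
  binary_form d (\sum_(mu <- msupp p | (mu i + mu j == d)%N) p@_mu *: 'X^(mu i)).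
Proof.
move=> ij homp; rewrite binary_form_sum /restrict_to_pair /comp_mpoly /mmap.
rewrite [RHS]big_mkcond big_seq [RHS]big_seq; apply: eq_bigr => mu mup.
have degmu : mdeg mu = d := dhomog_mf homp mup.
have ji : j != i by rewrite eq_sym.
pose rest := (\sum_(k < n | (k != i) && (k != j)) mu k)%N.
have restE : (mu i + mu j + rest)%N = d.
  by rewrite -degmu mdegE (bigD1 i) //= (bigD1 j) //= addnA.
case: eqP => [muij|nmuij].
  rewrite -muij binary_formZ binary_formXn ?leq_addr // addKn mul_mpolyC.
  congr (_ *: _); rewrite /mmap1 (bigD1 i) //= (bigD1 j) //=.
  rewrite !tnth_mktuple !eqxx orbT /= big1 ?mulr1 // => k kij.
  have : rest == 0%N by rewrite -(eqn_add2l (mu i + mu j)) restE muij addn0.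
  by rewrite sum_nat_eq0 => /forall_inP /(_ k kij) /eqP ->.
have : rest != 0%N by apply/eqP => rest0; apply: nmuij; rewrite -restE rest0 addn0.
rewrite sum_nat_eq0 negb_forall_in => /exists_inP[k /andP[ki kj] muk].
rewrite /mmap1 (bigD1 k) //= tnth_mktuple (negbTE ki) (negbTE kj) /=.
by rewrite expr0n (negbTE muk) mul0r mulr0.
Qed.

Lemma restrict_to_pair_eval (A : comNzRingType) (a : 'I_n -> A) p :
  (forall k, k != i -> k != j -> a k = 0) ->
  mmap intr a (restrict_to_pair i j p) = mmap intr a p.
Proof.
move=> a0; rewrite /restrict_to_pair /comp_mpoly mmap_comp.
apply: mmap_ext => [c|k] /=; first by rewrite mmapC.
rewrite tnth_mktuple; case: ifP => [_|/negbT]; first by rewrite mmapXU.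
by rewrite negb_or raddf0 => /andP[ki kj]; rewrite a0.
Qed.

Lemma binary_form_eval (A : comNzRingType) (a : 'I_n -> A) d q :
  mmap intr a (binary_form d q) = \sum_(k < d.+1) (q`_k)%:~R * (a i ^+ k * a j ^+ (d - k)).
Proof.
rewrite /binary_form raddf_sum; apply: eq_bigr => k _ /=.
by rewrite mmapZ rmorphM !rmorphXn /= !mmapXU.
Qed.

End BinaryForms.

(** The complex roots being integers, the linear factors can be split off over
the integers. *)
Lemma pm1_roots (C : numClosedFieldType) (q : {poly int}) : q != 0 ->
  (forall x : C, root (map_poly intr q) x -> x = 1 \/ x = -1) ->
  exists rs : seq int, {in rs, forall z, z = 1 \/ z = -1} /\
    q = lead_coef q *: \prod_(z <- rs) ('X - z%:P).
Proof.
elim: {q}(size q) {-2}q (leqnn (size q)) => [|N IH] q.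
  by rewrite leqn0 size_poly_eq0 => /eqP->; rewrite eqxx.
move=> sq q0 rootq; have [sq1|sq1] := leqP (size q) 1.
  exists [::]; split=> //; rewrite big_nil alg_polyC.
  by have [c ->] : exists c, q = c%:P; [exists q`_0; exact: size1_polyC|rewrite lead_coefC].
have [x rx] : exists x : C, root (map_poly intr q) x.
  apply/closed_rootP; rewrite size_map_inj_poly ?rmorph0 //; last exact: intr_inj.
  by rewrite gtn_eqF.
have [z zpm xz] : exists2 z : int, z = 1 \/ z = -1 & x = z%:~R.
  by have [->|->] := rootq x rx; [exists 1; [left|] | exists (-1); [right|]].
have rz : root q z.
  move: rx; rewrite xz /root horner_map /= => /eqP qz.
  by apply/eqP; apply: (@intr_inj C).
have /factor_theorem[r qr] := rz.
have r0 : r != 0 by apply: contraNneq q0 => r0; rewrite qr r0 mul0r.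
have sr : (size r <= N)%N.
  move: sq; rewrite qr size_Mmonic ?monicXsubC // size_XsubC addn2 /= ltnS.
  by [].
have [|rs [rspm rE]] := IH r sr r0.
  by move=> y ry; apply: rootq; rewrite qr rmorphM rootM ry.
exists (z :: rs); split.
  by move=> y; rewrite inE => /orP[/eqP->|/rspm].
rewrite big_cons qr lead_coef_Mmonic ?monicXsubC //.
by rewrite mulrC scalerAr -rE.
Qed.

Lemma meval_unit n (p : {mpoly int[n]}) d (i : 'I_n) : p \is d.-homog ->
  mmap intr (fun k => (k == i)%:R) p = p@_(U_(i) *+ d)%MM :> int.
Proof.
move=> homp; rewrite [in RHS](mpolyE p) /mmap raddf_sum /=.
rewrite big_seq [RHS]big_seq; apply: eq_bigr => mu mup.
have degmu : mdeg mu = d := dhomog_mf homp mup.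
rewrite mcoeffZ mcoeffX intz; congr (_ * _).
pose rest := (\sum_(k < n | k != i) mu k)%N.
have restE : (mu i + rest)%N = d by rewrite -degmu mdegE (bigD1 i).
rewrite /mmap1 (bigD1 i) //= eqxx expr1n mul1r.
case: eqP => [->|nmu].
  apply: big1 => k ki; rewrite (negbTE ki) mulmnE mnm1E eq_sym (negbTE ki) mul0n.
  by rewrite expr0.
have : rest != 0%N.
  apply/eqP => rest0; apply: nmu; apply/mnmP => k; rewrite mulmnE mnm1E eq_sym.
  have [->|ki] := eqVneq k i; first by rewrite mul1n -restE rest0 addn0.
  by move/eqP: rest0; rewrite sum_nat_eq0 mul0n => /forall_inP /(_ k ki) /eqP.
rewrite sum_nat_eq0 negb_forall_in => /exists_inP[k ki muk].
by rewrite (bigD1 k) //= (negbTE ki) expr0n (negbTE muk) mul0r.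
Qed.

Section AreaPolynomial.
Variables (R : realType) (m n : nat) (T : square_triangulation R m n).
Variables (p : {mpoly int[n]}) (areap : area_polynomial T p).
Let C : numClosedFieldType := R[i]%C.

Lemma area_polynomial_zero (i j : 'I_n) (a : 'I_n -> C) : i != j ->
  (forall k, k != i -> k != j -> a k = 0) -> a i != 0 \/ a j != 0 ->
  mmap intr a p = 0 -> a i + a j = 0 \/ a i = a j.
Proof.
case: areap => _ _ _ zeros ij a0 anz pa0; apply: (two_areas ij) a0.
apply/zeros; first by case: anz => ?; [exists i|exists j].
rewrite /meval /map_mpoly mmap_comp -[RHS]pa0; apply: mmap_ext => [c|k] /=.
  by rewrite mmapC.
by rewrite mmapXU.
Qed.

(** Dehomogenizing at [A_j = 1] gives a polynomial with no roots but 1 and -1. Its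
degree is [d], because its coefficient of degree [d] is the value of [p] at the
point whose only nonzero coordinate is [A_i = 1], which is not on the
variety. *)
Lemma restrict_area_polynomial (i j : 'I_n) d : i != j -> p \is d.-homog ->
  exists e f, restrict_to_pair i j p =
    p@_(U_(i) *+ d)%MM *: (('X_i + 'X_j) ^+ e * ('X_i - 'X_j) ^+ f).
Proof.
move=> ij homp; have ji : (j == i) = false by rewrite eq_sym (negbTE ij).
have formE := restrict_to_pairE ij homp.
set q := (\sum_(mu <- _ | _) _) in formE.
have sq : (size q <= d.+1)%N.
  apply: (big_ind (fun r : {poly int} => (size r <= d.+1)%N)).
  - by rewrite size_poly0.
  - by move=> r s sr ss; rewrite (leq_trans (size_polyD _ _)) // geq_max sr.
  move=> mu /eqP muij; rewrite (leq_trans (size_scale_leq _ _)) // size_polyXn.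
  by rewrite ltnS -muij leq_addr.
have evalE (A : comNzRingType) (x y : A) :
    let a k := if k == i then x else if k == j then y else 0 in
    mmap intr a p = \sum_(k < d.+1) (q`_k)%:~R * (x ^+ k * y ^+ (d - k)).
  move=> a; rewrite -(restrict_to_pair_eval (i := i) (j := j)) => [|k ki kj].
    by rewrite formE binary_form_eval /a !eqxx ji.
  by rewrite /a (negbTE ki) (negbTE kj).
have qd : p@_(U_(i) *+ d)%MM = q`_d.
  rewrite -(meval_unit i homp) -[RHS]intz.
  have := evalE int 1 0; rewrite big_ord_recr /= subnn expr0 expr1n !mulr1.
  rewrite big1 ?add0r => [<-|k _]; last first.
    by rewrite expr0n subn_eq0 leqNgt ltn_ord /= !mulr0.
  by apply: mmap_ext => // k; case: eqP => // _; case: eqP.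
have qd0 : q`_d != 0.
  have a0 k : k != i -> k != j -> (k == i)%:R = 0 :> C by move=> /negbTE->.
  apply/eqP => qd0; have := area_polynomial_zero ij a0.
  rewrite /= eqxx ji addr0 => H.
  suff /H : mmap intr (fun k => (k == i)%:R : C) p = 0.
    have one0 : (1 : C) <> 0 by apply/eqP; exact: oner_neq0.
    by move=> {}H; case: H => //; left; exact: oner_neq0.
  have := meval_unit i homp; rewrite qd qd0 => /(congr1 (fun z : int => z%:~R : C)).
  rewrite mulr0z => <-; rewrite mmap_comp; apply: mmap_ext => [c|k] /=.
    by rewrite intz.
  by rewrite rmorph_nat.
have sqE : size q = d.+1.
  by apply/eqP; rewrite eqn_leq sq ltnNge; apply: contra qd0 => /leq_sizeP->.
have q0 : q != 0 by rewrite -size_poly_eq0 sqE.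
have [|rs [rspm qE]] := pm1_roots (C := C) q0.
  move=> x /eqP qx.
  pose a k := if k == i then x else if k == j then 1 else 0.
  have [|||E|E] := @area_polynomial_zero i j a ij.
  - by move=> k ki kj; rewrite /a (negbTE ki) (negbTE kj).
  - by right; rewrite /a eqxx ji oner_neq0.
  - rewrite evalE -[RHS]qx (horner_coef_wide _ (leq_trans (size_poly _ _) sq)).
    apply: eq_bigr => k _; rewrite expr1n mulr1 coef_map_id0 ?rmorph0 //.
  - move: E; rewrite /a !eqxx ji => /eqP.
    by rewrite addr_eq0 => /eqP; right.
  - by move: E; rewrite /a !eqxx ji; left.
have srs : size rs = d.
  have := sqE; rewrite qE size_scale ?lead_coef_eq0 // size_prod_XsubC.
  by case.
exists (count_mem (-1) rs), (count_mem 1 rs).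
rewrite formE qE binary_formZ -srs binary_form_prod prod_pm1 // srs qd.
by rewrite lead_coefE sqE.
Qed.

End AreaPolynomial.

Theorem theorem31 (R : realType) (m n : nat) (T : square_triangulation R m n) :
  (forall (i j : 'I_n) (a : 'I_n -> R[i]%C), i != j ->
     area_variety T a -> a i != 0 -> a j != 0 ->
     (forall k, k != i -> k != j -> a k = 0) ->
     a i = a j \/ a i = - a j) /\
  (forall p : {mpoly int[n]}, area_polynomial T p ->
     (forall i j : 'I_n, i != j ->
        exists (c : int) (e f : nat),
          restrict_to_pair i j p = c *: (('X_i + 'X_j) ^+ e * ('X_i - 'X_j) ^+ f)) /\
     (forall i j : 'I_n,
        leading_coefficient p i = leading_coefficient p j \/
        leading_coefficient p i = - leading_coefficient p j)).
Proof.
split=> [i j a ij Va _ _ a0|p areap].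
  have [/eqP|] := two_areas ij Va a0; last by left.
  by rewrite addr_eq0 => /eqP; right.
have [[d homp] _ _ _] := areap; have {}homp := dhomog_msize homp.
split=> [i j ij|i j].
  have [e [f E]] := restrict_area_polynomial areap ij homp.
  by exists p@_(U_(i) *+ (msize p).-1)%MM, e, f.
have [->|ij] := eqVneq i j; first by left.
have ji : (j == i) = false by rewrite eq_sym (negbTE ij).
have [e [f E]] := restrict_area_polynomial areap ij homp.
(* Both sides are evaluated where A_j = 1 and all other areas vanish. *)
pose u k : int := (k == j)%:R.
have u0 k : k != i -> k != j -> u k = 0 by rewrite /u => _ /negbTE->.
have := restrict_to_pair_eval p u0.
rewrite (meval_unit j homp) E mmapZ rmorphM !rmorphXn rmorphD rmorphB /= !mmapXU.
rewrite /u (negbTE ij) eqxx add0r sub0r expr1n mul1r intz -signr_odd.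
rewrite /leading_coefficient => <-.
by case: (odd f); rewrite ?expr1 ?expr0 ?mulrN1 ?mulr1 ?opprK; [right|left].
Qed.
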